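(* Let $d=3$ and let $k_0,\nu,\omega,\chi,b$ and the sets $\Sigma_1,\Sigma_2,\Sigma_{2,\chi},\mathcal Y_1,\mathcal Y_2$ be as in the context. Assume that $b\in C^2(\Sigma_{2,\chi};\mathbb C)$ and that $$\overline{\{\sigma\in\Sigma_2\mid \nabla b(\sigma)\notin\mathbb C\,\pi_\sigma\nu\}}=\Sigma_2,$$ where the closure is taken relative to $\Sigma_2$ (i.e. the set is dense in $\Sigma_2$). Then every continuous solution $g\in C(\mathbb R^3;\mathbb C)$ of the homogeneous system (HS) satisfies $g(y)=0$ for all $y\in\mathcal Y_1\cup\mathcal Y_2$.
   Context: Setting ($d=3$): $k_0>0$; $\nu,\omega\in\mathbb R^3$ are unit vectors; $\langle\cdot,\cdot\rangle$ is the Euclidean inner product; $\mathbb S^{2}_{k_0}=\{x\in\mathbb R^3\mid\|x\|=k_0\}$; $e_3$ is the third standard basis vector. For $v\in\mathbb R^3\setminus\{0\}$ put $S_v=\{s\in\mathbb S^{2}_{k_0}\mid\langle s,v\rangle>0\}$. $H_\nu x=x-2\langle x,\nu\rangle\nu$. $\Sigma_1=\{\sigma\in S_\omega\mid H_\nu\sigma\notin S_\omega\}$, $\Sigma_2=\{\sigma\in S_\omega\mid H_\nu\sigma\in S_\omega\}$. $\mathcal Y_j=\{\eta-\sigma\mid\eta\in S_{e_3},\ \sigma\in\Sigma_j\}$ for $j=1,2$. Fix $\chi\in(0,1)$ and let $\Sigma_{2,\chi}=\{\tilde\chi\sigma\mid\sigma\in\Sigma_2,\ \tilde\chi\in(1-\chi,1+\chi)\}\subseteq\mathbb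 R^3$ (an open set). $b:\Sigma_{2,\chi}\to\mathbb C\setminus\{0\}$ is a function with $b(\tilde\chi\sigma)=b(\sigma)$ for all $\sigma\in\Sigma_2$, $\tilde\chi\in(1-\chi,1+\chi)$. Homogeneous system (HS) for $g:\mathbb R^3\to\mathbb C$: for all $\eta\in S_{e_3}$, $g(\eta-\sigma)=0$ for every $\sigma\in\Sigma_1$, and $b(\sigma)g(\eta-\sigma)+g(\eta-H_\nu\sigma)=0$ for every $\sigma\in\Sigma_2$. For $\sigma\in\mathbb R^3\setminus\{0\}$, $\pi_\sigma x=x-\langle x,\sigma\rangle\sigma/\|\sigma\|^2$ is the orthogonal projection onto $\sigma^\perp$. $\nabla b(\sigma)\in\mathbb C^3$ is the gradient, and $\mathbb C\,\pi_\sigma\nu$ is the set of complex multiples of $\pi_\sigma\nu$. *)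

(* Defs.v *)
From mathcomp Require Import all_boot all_order all_algebra.
From mathcomp Require Export complex.
From mathcomp Require Import boolp classical_sets reals topology normedtype derive.

Set Implicit Arguments.
Unset Strict Implicit.
Unset Printing Implicit Defensive.

Import Order.TTheory GRing.Theory Num.Theory.
Import numFieldNormedType.Exports.

Local Open Scope classical_set_scope.
Local Open Scope ring_scope.
Local Open Scope complex_scope.

Section Euclidean.
Variables (R : realType) (n : nat).
Implicit Types (x y v nu s : 'rV[R]_n) (U : set 'rV[R]_n).

Definition dot x y : R := \sum_i x 0 i * y 0 i.

(* The library norm `|x| on row vectors is the sup norm. *)
Definition enorm x : R := Num.sqrt (dot x x).

Definition sphere (k0 : R) : set 'rV[R]_n := [set x | enorm x = k0].

Definition cap (k0 : R) v : set 'rV[R]_n := [set s | sphere k0 s /\ 0 < dot s v].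

Definition refl nu x : 'rV[R]_n := x - (2 * dot x nu) *: nu.

(* Projection onto the orthogonal complement of s; meaningful for s != 0. *)
Definition oproj s x : 'rV[R]_n := x - (dot x s / enorm s ^+ 2) *: s.

Definition partial (i : 'I_n) (f : 'rV[R]_n -> R) (x : 'rV[R]_n) : R :=
  'D_(delta_mx 0 i) f x.

(* C^k on an open set U, with Frechet differentiability; for open U this only
   depends on the restriction of f to U. *)
Fixpoint Ck (k : nat) U (f : 'rV[R]_n -> R) : Prop :=
  match k with
  | 0 => forall x, U x -> {for x, continuous f}
  | k'.+1 => (forall x, U x -> differentiable f x) /\
             (forall i, Ck k' U (partial i f))
  end.

Definition CkC (k : nat) U (f : 'rV[R]_n -> R[i]) : Prop :=
  Ck k U (fun x => complex.Re (f x)) /\ Ck k U (fun x => complex.Im (f x)).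

Definition gradC (f : 'rV[R]_n -> R[i]) (x : 'rV[R]_n) : 'rV[R[i]]_n :=
  \row_i (partial i (fun y => complex.Re (f y)) x
          +i* partial i (fun y => complex.Im (f y)) x).

(* The complex line spanned by a real vector. *)
Definition cline (v : 'rV[R]_n) : set 'rV[R[i]]_n :=
  [set c *: map_mx (real_complex R) v | c in [set: R[i]]].

(* [R[i]^o] carries the library topology given by the modulus on R[i]. *)
Definition continuousC (g : 'rV[R]_n -> R[i]) : Prop :=
  continuous (g : 'rV[R]_n -> R[i]^o).

End Euclidean.

Section System.
Variable R : realType.
Implicit Types (chi : R) (nu omega : 'rV[R]_3).

Definition e3 : 'rV[R]_3 := delta_mx 0 ord_max.

Definition Sigma1 (k0 : R) nu omega : set 'rV[R]_3 :=
  [set s | cap k0 omega s /\ ~ cap k0 omega (refl nu s)].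

Definition Sigma2 (k0 : R) nu omega : set 'rV[R]_3 :=
  [set s | cap k0 omega s /\ cap k0 omega (refl nu s)].

Definition Sigma2chi (k0 : R) nu omega chi : set 'rV[R]_3 :=
  [set t *: s | s in Sigma2 k0 nu omega & t in `]1 - chi, 1 + chi[].

Definition Y1 (k0 : R) nu omega : set 'rV[R]_3 :=
  [set eta - s | eta in cap k0 e3 & s in Sigma1 k0 nu omega].

Definition Y2 (k0 : R) nu omega : set 'rV[R]_3 :=
  [set eta - s | eta in cap k0 e3 & s in Sigma2 k0 nu omega].

Definition HS (k0 : R) nu omega (b g : 'rV[R]_3 -> R[i]) : Prop :=
  forall eta, cap k0 e3 eta ->
    (forall s, Sigma1 k0 nu omega s -> g (eta - s) = 0) /\
    (forall s, Sigma2 k0 nu omega s ->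
       b s * g (eta - s) + g (eta - refl nu s) = 0).

End System.

(* Main.v *)
(* Suppose [g (eta0 - s0) != 0] with [s0] in [Sigma2]; write [H] for the
   reflection and [h = <s, nu>].  Near [(eta0, s0)] the system gives
   [g (Y + 2 d nu) / g Y = b (c d) / b s], where [Y = eta - H s] and [c] runs
   through the circle of points [c d] of the sphere with
   [|Y - 2 h nu + c d| = k0], parametrised by [<c d, nu> = h + d].  The left-hand
   side does not involve [s], so if two points [s1], [s2] share the same [Y],
   the logarithmic derivatives of [b] along their circles agree at [d = 0].
   The admissible [Y] for fixed [s1], [s2] form an arc of a circle through the
   origin; parametrising it by a line of directions turns this equality into
   the vanishing of a cubic polynomial.  Its leading coefficient, computed in
   the direction where the circle of [s1] has velocity orthogonal to [nu], is a
   nonzero multiple of the derivative of [b] at [s1] along [nu x s1].  Hence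
   that derivative vanishes for generic [s1] near [s0]; as [b] is also radially
   constant, [nabla b (s1)] lies in [C pi_s1 nu], contradicting density. *)

Require Import Defs.
From mathcomp Require Import all_boot all_order all_algebra complex ring lra.
From mathcomp Require Import boolp classical_sets functions reals topology.
From mathcomp Require Import normedtype derive realfun.

Set Implicit Arguments.
Unset Strict Implicit.
Unset Printing Implicit Defensive.

Import Order.TTheory GRing.Theory Num.Theory.
Import numFieldNormedType.Exports.
Local Open Scope classical_set_scope.
Local Open Scope ring_scope.
Local Open Scope complex_scope.

(** * Bilinear algebra of the inner product and of the reflection *)

Section Dot.
Variables (R : realType) (n : nat).
Implicit Types (x y z nu : 'rV[R]_n) (a : R).

Lemma dotC x y : dot x y = dot y x.
Proof. by apply: eq_bigr => i _; rewrite mulrC. Qed.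

Lemma dotDl x y z : dot (x + y) z = dot x z + dot y z.
Proof. by rewrite -big_split; apply: eq_bigr => i _; rewrite mxE mulrDl. Qed.

Lemma dotZl a x z : dot (a *: x) z = a * dot x z.
Proof. by rewrite mulr_sumr; apply: eq_bigr => i _; rewrite mxE mulrA. Qed.

Lemma dotDr x y z : dot z (x + y) = dot z x + dot z y.
Proof. by rewrite dotC dotDl !(dotC z). Qed.

Lemma dotZr a x z : dot z (a *: x) = a * dot z x.
Proof. by rewrite dotC dotZl dotC. Qed.

Lemma dotNl x z : dot (- x) z = - dot x z.
Proof. by rewrite -scaleN1r dotZl mulN1r. Qed.

Lemma dotNr x z : dot z (- x) = - dot z x.
Proof. by rewrite dotC dotNl dotC. Qed.

Lemma dot0l x : dot 0 x = 0.
Proof. by rewrite -(scale0r 0) dotZl mul0r. Qed.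

Lemma dot0r x : dot x 0 = 0.
Proof. by rewrite dotC dot0l. Qed.

Definition dotE := (dotDl, dotDr, dotNl, dotNr, dotZl, dotZr, dot0l, dot0r).

Lemma dot_sqrD x y : dot (x + y) (x + y) = dot x x + 2 * dot x y + dot y y.
Proof. by rewrite !dotE (dotC y x); ring. Qed.

Lemma dot_ge0 x : 0 <= dot x x.
Proof. by apply: sumr_ge0 => i _; rewrite -expr2 sqr_ge0. Qed.

Lemma dot_eq0 x : dot x x = 0 -> x = 0.
Proof.
move=> x0; apply/rowP => i; rewrite mxE; apply/eqP; rewrite -sqrf_eq0 expr2.
by rewrite (psumr_eq0P _ x0)// => j _; rewrite -expr2 sqr_ge0.
Qed.

Lemma dot_gt0 x : x != 0 -> 0 < dot x x.
Proof.
by move=> x0; rewrite lt0r dot_ge0 andbT; apply: contra x0 => /eqP/dot_eq0->.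
Qed.

Lemma sphereE (k : R) x : 0 < k -> sphere k x <-> dot x x = k ^+ 2.
Proof.
move=> k0; rewrite /sphere /enorm /=; split => [<-|->].
  by rewrite sqr_sqrtr// dot_ge0.
by rewrite sqrtr_sqr gtr0_norm.
Qed.

Lemma cvg_dot {T} (F : set_system T) {FF : Filter F} (f g : T -> 'rV[R]_n) x y :
  f @ F --> x -> g @ F --> y -> (fun t => dot (f t) (g t)) @ F --> dot x y.
Proof.
move=> fx gy.
apply: (cvg_big (op := +%R)) => [|i _].
  by move=> ?; exact: add_continuous.
apply: cvgM.
  exact: (cvg_comp f (fun M : 'rV_n => M 0 i) fx)
    (@coord_continuous R 1 n 0 i x).
exact: (cvg_comp g (fun M : 'rV_n => M 0 i) gy)
  (@coord_continuous R 1 n 0 i y).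
Qed.

Lemma cvg_dotr {T} (F : set_system T) {FF : Filter F} (f : T -> 'rV[R]_n) x y :
  f @ F --> x -> (fun t => dot (f t) y) @ F --> dot x y.
Proof. by move=> fx; apply: cvg_dot => //; exact: cvg_cst. Qed.

Lemma cvg_dotl {T} (F : set_system T) {FF : Filter F} (f : T -> 'rV[R]_n) x y :
  f @ F --> x -> (fun t => dot y (f t)) @ F --> dot y x.
Proof. by move=> fx; apply: cvg_dot => //; exact: cvg_cst. Qed.

Lemma continuous_dotr y : continuous (fun x => dot x y).
Proof. by move=> x; exact: (@cvg_dotr _ (nbhs x) _ id _ _ cvg_id). Qed.

Lemma dot_refl_normal nu x : dot nu nu = 1 -> dot (refl nu x) nu = - dot x nu.
Proof. by move=> nu1; rewrite /refl !dotE nu1; ring. Qed.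

Lemma dot_refl nu x y : dot nu nu = 1 -> dot (refl nu x) (refl nu y) = dot x y.
Proof. by move=> nu1; rewrite /refl !dotE nu1 !(dotC nu); ring. Qed.

Lemma dot_reflC nu x y : dot (refl nu x) y = dot x (refl nu y).
Proof. by rewrite /refl !dotE (dotC nu); ring. Qed.

Lemma reflK nu : dot nu nu = 1 -> involutive (refl nu).
Proof.
move=> nu1 x; rewrite [LHS]/refl dot_refl_normal// /refl mulrN scaleNr opprK.
by rewrite subrK.
Qed.

End Dot.

(** * Cross product and determinant identities in dimension three *)

Section Cross.
Variable R : realType.
Implicit Types (x y z w : 'rV[R]_3) (a : R).

(** Indices are added in ['I_3], hence modulo 3, so a single cyclic formula covers all three
    coordinates. *)
Definition cross x y : 'rV[R]_3 :=
  \row_i (x 0 (i + 1) * y 0 (i + 2) - x 0 (i + 2) * y 0 (i + 1)).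

Lemma dot3E x y : dot x y = x 0 0 * y 0 0 + x 0 1 * y 0 1 + x 0 2 * y 0 2.
Proof.
rewrite /dot !big_ord_recl big_ord0 addr0 addrA.
by congr (_ * _ + x 0 _ * y 0 _ + x 0 _ * y 0 _); apply/val_inj.
Qed.

Lemma ord3_eq : (0 + 1 = 1 :> 'I_3) * (0 + 2 = 2 :> 'I_3) * (1 + 1 = 2 :> 'I_3)
  * (1 + 2 = 0 :> 'I_3) * (2 + 1 = 0 :> 'I_3) * (2 + 2 = 1 :> 'I_3).
Proof. by do !split; apply/val_inj. Qed.

Lemma row3P x y : x 0 0 = y 0 0 -> x 0 1 = y 0 1 -> x 0 2 = y 0 2 -> x = y.
Proof.
move=> e0 e1 e2; apply/rowP => -[[|[|[|//]]] ilt].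
- by have -> : Ordinal ilt = 0 by apply/val_inj.
- by have -> : Ordinal ilt = 1 by apply/val_inj.
- by have -> : Ordinal ilt = 2 by apply/val_inj.
Qed.

Lemma crossZl a x y : cross (a *: x) y = a *: cross x y.
Proof. by apply/rowP => i; rewrite !mxE; ring. Qed.

Lemma crossDl x y z : cross (x + y) z = cross x z + cross y z.
Proof. by apply/rowP => i; rewrite !mxE; ring. Qed.

Lemma crossNl x z : cross (- x) z = - cross x z.
Proof. by apply/rowP => i; rewrite !mxE; ring. Qed.

Lemma crossxx x : cross x x = 0.
Proof. by apply/rowP => i; rewrite !mxE; ring. Qed.

Lemma crossC x y : cross x y = - cross y x.
Proof. by apply/rowP => i; rewrite !mxE; ring. Qed.

Lemma crossZr a x y : cross x (a *: y) = a *: cross x y.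
Proof. by apply/rowP => i; rewrite !mxE; ring. Qed.

Lemma crossDr x y z : cross z (x + y) = cross z x + cross z y.
Proof. by apply/rowP => i; rewrite !mxE; ring. Qed.

Lemma crossNr x z : cross z (- x) = - cross z x.
Proof. by apply/rowP => i; rewrite !mxE; ring. Qed.

Lemma dot_crossC x y z : dot (cross x y) z = dot x (cross y z).
Proof. by rewrite !dot3E !mxE !ord3_eq; ring. Qed.

Lemma dot_crossxx x y : dot x (cross x y) = 0.
Proof. by rewrite -dot_crossC crossxx dot0l. Qed.

Lemma dot_crossxy x y : dot y (cross x y) = 0.
Proof. by rewrite crossC dotNr dot_crossxx oppr0. Qed.

Lemma lagrange_identity x y z w :
  dot (cross x y) (cross z w) = dot x z * dot y w - dot x w * dot y z.
Proof. by rewrite !dot3E !mxE !ord3_eq; ring. Qed.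

(** Up to the determinant, this expands [w] in the basis dual to [x], [y], [z]; when the determinant
    is nonzero, three inner products determine [w]. *)
Lemma cramer3 x y z w : dot (cross x y) z *: w =
  dot w x *: cross y z + dot w y *: cross z x + dot w z *: cross x y.
Proof.
by apply/row3P; rewrite !mxE !dot3E !mxE !ord3_eq; ring.
Qed.

End Cross.

(** * Local parametrisation of circles on a sphere *)

Section Curve.
Variable R : realType.

(* The circle through [s] about the axis [y], parametrised by its height along
   [v]: [X] is the velocity at [s] and the normal correction [mu] is the
   root tending to 0 of a quadratic equation, in rationalised form. *)
Lemma circle_curve (y s v : 'rV[R]_3) : dot (cross y s) v != 0 ->
  exists F : R -> 'rV[R]_3,
  [/\ F d @[d --> 0] --> F 0,
      F 0 = (dot (cross y s) v)^-1 *: cross y s &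
      \forall d \near 0, [/\ dot (s + d *: F d) (s + d *: F d) = dot s s,
        dot (s + d *: F d) y = dot s y &
        dot (s + d *: F d) v = dot s v + d]].
Proof.
set D := dot _ v => D0.
(* As [n] is orthogonal to [y] and [v], adding multiples of it changes neither height. Preserving
   the norm of [s + d *: (X + mu *: n)] for d nonzero means d |n|^2 mu^2 + 2 B mu + d |X|^2 = 0. Its
   discriminant is 4 B^2 A, and multiplying by the conjugate root removes the division by d. *)
pose n := cross y v; pose X := D^-1 *: cross y s.
pose B d : R := - D + d * dot X n.
pose A d : R := 1 - dot n n * dot X X * d ^+ 2 / B d ^+ 2.
pose r d := Num.sqrt (A d).
pose mu d := - (d * dot X X) / (B d * (1 + r d)).
have B0 : B 0 = - D by rewrite /B mul0r addr0.
have A0 : A 0 = 1 by rewrite /A expr0n mulr0 mul0r subr0.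
have cB : B d @[d --> 0] --> B 0.
  by apply: cvgD; [exact: cvg_cst|apply: cvgM; [exact: cvg_id|exact: cvg_cst]].
have B0n : B 0 != 0 by rewrite B0 oppr_eq0.
have cA : A d @[d --> 0] --> A 0.
  apply: cvgB; first exact: cvg_cst.
  apply: cvgM.
    apply: cvgM; first exact: cvg_cst.
    by apply: cvgM; exact: cvg_id.
  by apply: cvgV; [rewrite expf_neq0|apply: cvgM].
have cr : r d @[d --> 0] --> r 0.
  exact: (cvg_comp A Num.sqrt cA (@sqrt_continuous R _)).
have r1 d : 1 + r d != 0 by rewrite gt_eqF// ltr_pwDl// sqrtr_ge0.
have cmu : mu d @[d --> 0] --> mu 0.
  apply: cvgM.
    by apply: cvgN; apply: cvgM; [exact: cvg_id|exact: cvg_cst].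
  apply: cvgV; first by rewrite mulf_neq0.
  by apply: cvgM => //; apply: cvgD => //; exact: cvg_cst.
have mu0 : mu 0 = 0 by rewrite /mu mul0r oppr0 mul0r.
exists (fun d => X + mu d *: n); split.
- apply: cvgD; first exact: cvg_cst.
  by apply: cvgZ => //; exact: cvg_cst.
- by rewrite mu0 scale0r addr0.
near=> d.
have Ad : 0 <= A d by near: d; apply: (cvgr_ge _ cA); rewrite A0.
have Bd : B d != 0 by near: d; apply: (cvgr_neq0 _ cB).
have r2 : r d ^+ 2 = A d by rewrite sqr_sqrtr.
have Xy : dot X y = 0 by rewrite dotZl dotC dot_crossxx mulr0.
have Xs : dot X s = 0 by rewrite dotZl dotC dot_crossxy mulr0.
have Xv : dot X v = 1 by rewrite dotZl mulVf.
have ny : dot n y = 0 by rewrite dotC dot_crossxx.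
have nv : dot n v = 0 by rewrite dotC dot_crossxy.
have sn : dot s n = - D.
  by rewrite /n -dot_crossC crossC dotNl.
clearbody n X; split; rewrite ?dotE ?Xy ?ny ?Xv ?nv; [|ring|ring].
rewrite (dotC n s) (dotC n X) (dotC s X) Xs sn.
transitivity
  (dot s s + d * (d * dot X X + 2 * mu d * B d + d * mu d ^+ 2 * dot n n)).
  by rewrite /B; ring.
suff -> : d * dot X X + 2 * mu d * B d + d * mu d ^+ 2 * dot n n = 0.
  by rewrite mulr0 addr0.
have nq : dot n n * dot X X * d ^+ 2 = (1 - r d ^+ 2) * B d ^+ 2.
  by rewrite r2 /A opprB addrC subrK divfK// expf_neq0.
have -> : d * dot X X + 2 * mu d * B d + d * mu d ^+ 2 * dot n n = 
  d * dot X X * (1 - 2 / (1 + r d)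
   + dot n n * dot X X * d ^+ 2 / (B d ^+ 2 * (1 + r d) ^+ 2)).
  by rewrite /mu; field; rewrite Bd r1.
by rewrite nq; field; rewrite Bd r1.
Unshelve. all: by end_near. Qed.

End Curve.

Lemma near_neq0 (R : realType) T (F : set_system T) {FF : Filter F}
    (f : T -> R) (y : R) :
  f x @[x --> F] --> y -> y != 0 -> \forall x \near F, f x != 0.
Proof. exact: (@cvgr_neq0 R R). Qed.

(** * Choice of a second point sharing the same difference vector *)

Section Reflection.
Variable R : realType.
Implicit Types nu x y s : 'rV[R]_3.

(** The reflection changes [x] and [y] only by multiples of [nu], which drop out of a determinant
    with [nu]. *)
Lemma det_refl nu x y :
  dot (cross (refl nu x) (refl nu y)) nu = dot (cross x y) nu.
Proof. by rewrite !dot3E !mxE !ord3_eq; ring. Qed.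

Lemma cvg_refl nu T (F : set_system T) {FF : Filter F} (f : T -> 'rV[R]_3) x :
  f @ F --> x -> (fun t => refl nu (f t)) @ F --> refl nu x.
Proof.
move=> fx; apply: cvgB => //; apply: cvgZ; last exact: cvg_cst.
by apply: cvgM; [exact: cvg_cst|apply: cvg_dot => //; exact: cvg_cst].
Qed.

Lemma cvg_add_refl nu Y T (F : set_system T) {FF : Filter F}
    (f : T -> 'rV[R]_3) x :
  f @ F --> x -> (fun t => Y + refl nu (f t)) @ F --> Y + refl nu x.
Proof. by move=> fx; apply: cvgD; [exact: cvg_cst|exact: cvg_refl]. Qed.

(** Rotating [t1] slightly about the axis [Y] keeps its norm and its product with [Y]; reflecting
    back gives [s2]. The three quantities that must not vanish are all zero at the start, but each
    is the displacement d times a factor with nonzero limit. *)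
Lemma exists_second_point nu s1 Y (V : set 'rV[R]_3) :
  let t1 := refl nu s1 in
  dot nu nu = 1 -> nbhs s1 V -> dot s1 nu != 0 ->
  dot (cross Y t1) nu != 0 ->
  dot t1 t1 * dot Y nu - dot t1 Y * dot t1 nu != 0 ->
  exists s2, [/\ V s2, dot s2 s2 = dot s1 s1, dot (refl nu s2) Y = dot t1 Y &
    [/\ dot s1 nu != dot s2 nu,
    dot s1 s1 - dot s1 s2 - dot s1 nu ^+ 2 + dot s1 nu * dot s2 nu != 0 &
    dot (cross s1 s2) nu != 0]].
Proof.
move=> t1 nu1 Vs1 h1 D0 G0.
have [F [cF F0 Fcirc]] := circle_curve D0.
pose c d := t1 + d *: F d.
have cc : c d @[d --> 0] --> t1.
  rewrite -[X in _ --> X]addr0 -(scale0r (F 0)).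
  by apply: cvgD; [exact: cvg_cst|apply: cvgZ].
have cs : refl nu (c d) @[d --> 0] --> s1.
  by rewrite -[X in _ --> X](reflK nu1); exact: cvg_refl.
have t1nu : dot t1 nu = - dot s1 nu by rewrite dot_refl_normal.
have : \forall d \near (0 : R)^', [/\ V (refl nu (c d)),
  dot (refl nu (c d)) (refl nu (c d)) = dot s1 s1,
  dot (refl nu (refl nu (c d))) Y = dot t1 Y &
  [/\ dot s1 nu != dot (refl nu (c d)) nu,
   dot s1 s1 - dot s1 (refl nu (c d)) - dot s1 nu ^+ 2
    + dot s1 nu * dot (refl nu (c d)) nu != 0 &
   dot (cross s1 (refl nu (c d))) nu != 0]]; last first.
  by move=> /filter_ex[d Pd]; exists (refl nu (c d)).
near=> d.
have d0 : d != 0 by near: d; exact: nbhs_dnbhs_neq.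
have [cn cy cnu] : [/\ dot (c d) (c d) = dot t1 t1, dot (c d) Y = dot t1 Y &
    dot (c d) nu = dot t1 nu + d].
  by near: d; apply: cvg_within.
have s1E : s1 = refl nu t1 by rewrite /t1 reflK.
have h2 : dot (refl nu (c d)) nu = dot s1 nu - d.
  by rewrite dot_refl_normal// cnu t1nu; ring.
split.
- by near: d; apply: cvg_within; exact: cs.
- by rewrite dot_refl// cn dot_refl.
- by rewrite reflK// cy.
split.
- by rewrite h2 -subr_eq0 opprB addrC subrK.
- have -> : dot s1 (refl nu (c d)) = dot s1 s1 + d * dot t1 (F d).
    by rewrite {1}s1E dot_refl// /c dotDr dotZr dot_refl.
  rewrite h2.
  have -> : dot s1 s1 - (dot s1 s1 + d * dot t1 (F d)) - dot s1 nu ^+ 2 +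
    dot s1 nu * (dot s1 nu - d) = - d * (dot t1 (F d) + dot s1 nu) by ring.
  (* [F 0] is a multiple of [cross Y t1], hence orthogonal to [t1], so the second factor tends to
     [dot s1 nu]. *)
  rewrite mulf_neq0 ?oppr_eq0//.
  near: d; apply: cvg_within.
  suff: \forall e \near (0 : R), dot t1 (F e) + dot s1 nu != 0 by [].
  have : dot t1 (F e) + dot s1 nu @[e --> (0 : R)]
      --> dot t1 (F 0) + dot s1 nu.
    by apply: cvgD; [exact: cvg_dotl|exact: cvg_cst].
  by rewrite F0 dotZr dot_crossxy mulr0 add0r => /near_neq0; exact.
(* By the Lagrange identity the limit of the remaining factor is, up to a nonzero scalar, the
   quantity assumed nonzero in the last hypothesis. *)
- rewrite {1}s1E det_refl /c crossDr crossxx add0r crossZr dotZl mulf_neq0//.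
  rewrite crossC dotNl oppr_eq0.
  near: d; apply: cvg_within.
  suff: \forall e \near (0 : R), dot (cross (F e) t1) nu != 0 by [].
  have : dot (cross (F e) t1) nu @[e --> (0 : R)] --> dot (cross (F 0) t1) nu.
    under eq_fun do rewrite dot_crossC.
    by rewrite dot_crossC; exact: cvg_dotr.
  move=> /near_neq0; apply; rewrite F0 crossZl dotZl mulf_neq0 ?invr_eq0//.
  rewrite dot_crossC lagrange_identity (dotC Y t1).
  by move: G0; apply: contra => /eqP G0; apply/eqP; lra.
Unshelve. all: by end_near. Qed.

End Reflection.

(** * Elimination of the second covector by a cubic polynomial *)

Section Covectors.
Variable R : realType.
Implicit Types nu s v w Y : 'rV[R]_3.

(* For a cubic polynomial, [a] is its leading coefficient. *)
Lemma cubic_lead_eq0 (P : R -> R) (a : R) :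
  (forall t, P (t * 2) - 2 * P t + 2 * P (- t) - P (- (t * 2)) =
             12 * t ^+ 3 * a) ->
  (\forall t \near 0, P t = 0) -> a = 0.
Proof.
move=> PE /nbhs_ballP[e /= e0 P0].
have Pt t : `|t| < e -> P t = 0.
  by move=> te; apply: P0; rewrite /ball /= sub0r normrN.
(* The combination in the hypothesis is a third central difference; this [t] keeps its four nodes,
   [t], [t * 2] and their opposites, within [e] of 0. *)
pose t := e / 4.
have t0 : 0 < t by rewrite divr_gt0.
have te : t * 2 < e by rewrite /t; lra.
have abs x : - e < x -> x < e -> P x = 0.
  by move=> x1 x2; apply: Pt; rewrite ltr_norml x1.
have := PE t; rewrite !abs; [|lra..].
rewrite mulr0 subrr addr0 subrr => /esym.
move=> /eqP; rewrite mulf_eq0 => /orP[|/eqP//].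
by rewrite gt_eqF// mulr_gt0// exprn_gt0.
Qed.

(** The two equations on [Y] cut out a circle through 0 in the plane orthogonal to
    [refl nu s1 - refl nu s2]. Parametrised by directions along a line in that plane, the relation
    becomes a vanishing cubic. The line is chosen so that [w2] disappears from the leading
    coefficient. *)
Lemma tangential_covector_eq0 nu s1 s2 Y0 w1 w2 :
  dot nu nu = 1 -> dot s2 s2 = dot s1 s1 -> s1 != 0 -> Y0 != 0 ->
  dot Y0 Y0 + 2 * dot Y0 (refl nu s1) = 0 ->
  dot Y0 Y0 + 2 * dot Y0 (refl nu s2) = 0 ->
  (\forall Y \near Y0, dot Y Y + 2 * dot Y (refl nu s1) = 0 ->
    dot Y Y + 2 * dot Y (refl nu s2) = 0 ->
    dot w1 (cross (Y - (2 * dot s1 nu) *: nu) s1) * dot (cross Y s2) nu =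
    dot w2 (cross (Y - (2 * dot s2 nu) *: nu) s2) * dot (cross Y s1) nu) ->
  dot s1 nu != dot s2 nu ->
  dot s1 s1 - dot s1 s2 - dot s1 nu ^+ 2 + dot s1 nu * dot s2 nu != 0 ->
  dot (cross s1 s2) nu != 0 ->
  dot w1 (cross nu s1) = 0.
Proof.
move=> nu1 s21 s10 Y00 E1 E2 H h12 z0 D0.
set h1 := dot s1 nu in H h12 z0 *; set h2 := dot s2 nu in H h12 z0 *.
set K := dot s1 s1 in s21 z0.
(* Taking [v1] in the span of [s1] and [nu] makes [cross v1 s1] orthogonal to [nu]; [be] is then
   solved from [T s1 v1 = T s2 v1], which puts [v1] in the plane of the circle. *)
pose a := h1 - h2; pose be := K - 2 * h1 ^+ 2 - dot s1 s2 + 2 * h1 * h2.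
pose v1 := a *: s1 + be *: nu.
pose v t := Y0 + t *: v1.
pose T s y := dot y (refl nu s).
(* The line through 0 and [v t] meets the sphere [dot Y Y + 2 * T s1 Y = 0] at 0 and at
   [rho t *: v t]. *)
pose rho t := - 2 * T s1 (v t) / dot (v t) (v t).
have cv : v t @[t --> (0 : R)] --> Y0.
  rewrite -[X in _ --> X]addr0 -(scale0r v1).
  by apply: cvgD; [exact: cvg_cst|apply: cvgZ; [exact: cvg_id|exact: cvg_cst]].
have v0 : v 0 = Y0 by rewrite /v scale0r addr0.
have cvv : dot (v t) (v t) @[t --> (0 : R)] --> dot Y0 Y0 by exact: cvg_dot.
have Y0Y0 : dot Y0 Y0 != 0 by rewrite gt_eqF// dot_gt0.
have crho : rho t @[t --> (0 : R)] --> (1 : R).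
  have -> : 1 = - 2 * T s1 Y0 / dot Y0 Y0.
    have -> : - 2 * T s1 Y0 = dot Y0 Y0 by rewrite /T; lra.
    by rewrite divff.
  apply: cvgM; last exact: cvgV.
  by apply: cvgM; [exact: cvg_cst|exact: cvg_dotr].
have cY : rho t *: v t @[t --> (0 : R)] --> Y0.
  by rewrite -[X in _ --> X]scale1r; exact: cvgZ.
have T12 y : T s1 y - T s2 y = dot y (s1 - s2) - 2 * a * dot y nu.
  by rewrite /T /refl !dotE /a /h1 /h2; ring.
have Tv1 : T s1 v1 = T s2 v1.
  apply/eqP; rewrite -subr_eq0 T12 /v1 !dotE -/K -/h1 (dotC nu s1) (dotC nu s2).
  by rewrite nu1 -/h1 -/h2 /a /be; apply/eqP; ring.
have TY0 : T s1 Y0 = T s2 Y0 by rewrite /T; lra.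
have Tv s t : T s (v t) = T s Y0 + t * T s v1 by rewrite /T /v dotDl dotZl.
pose l s w y := dot w (cross y s).
pose M s w := 2 * dot s nu * dot w (cross nu s).
pose De s y := dot (cross y s) nu.
(* Substituting [rho] into the relation and clearing denominators yields a form homogeneous of
   degree 3 in [y]; hence [Phi v1] is the coefficient of t^3 in [Phi (v t)]. *)
pose Phi y := (2 * T s1 y * l s1 w1 y + M s1 w1 * dot y y) * De s2 y
  - (2 * T s1 y * l s2 w2 y + M s2 w2 * dot y y) * De s1 y.
have Phi0 : \forall t \near (0 : R), Phi (v t) = 0.
  near=> t.
  have vv0 : dot (v t) (v t) != 0 by near: t; exact: (near_neq0 cvv).
  have r0 : rho t != 0.
    by near: t; apply: (near_neq0 crho); rewrite oner_eq0.
  have Tr : 2 * T s1 (v t) = - rho t * dot (v t) (v t).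
    by rewrite /rho; field.
  have : dot (rho t *: v t) (rho t *: v t)
      + 2 * dot (rho t *: v t) (refl nu s1) = 0 ->
    dot (rho t *: v t) (rho t *: v t)
      + 2 * dot (rho t *: v t) (refl nu s2) = 0 ->
    dot w1 (cross (rho t *: v t - (2 * h1) *: nu) s1)
      * dot (cross (rho t *: v t) s2) nu =
    dot w2 (cross (rho t *: v t - (2 * h2) *: nu) s2)
      * dot (cross (rho t *: v t) s1) nu.
    by near: t; exact: (cY _ H).
  have lM s w : dot w (cross (rho t *: v t - (2 * dot s nu) *: nu) s) =
      rho t * l s w (v t) - M s w.
    by rewrite crossDl crossNl !crossZl dotDr dotNr !dotZr /l /M; ring.
  have DeZ s : dot (cross (rho t *: v t) s) nu = rho t * De s (v t).
    by rewrite crossZl dotZl.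
  rewrite !lM !DeZ !dotZl !dotZr -!/(T _ _).
  have T2 : T s2 (v t) = T s1 (v t) by rewrite !Tv Tv1 TY0.
  have E0 : rho t * (rho t * dot (v t) (v t)) + 2 * (rho t * T s1 (v t)) = 0.
    have -> : 2 * (rho t * T s1 (v t)) = rho t * (2 * T s1 (v t)) by ring.
    by rewrite Tr; ring.
  rewrite T2 => /(_ E0 E0) HE.
  apply: (mulfI r0); rewrite mulr0 /Phi Tr.
  transitivity (- dot (v t) (v t) * ((rho t * l s1 w1 (v t) - M s1 w1) *
    (rho t * De s2 (v t)) - (rho t * l s2 w2 (v t) - M s2 w2) *
    (rho t * De s1 (v t)))); first by ring.
  by rewrite HE subrr mulr0.
have lv s w t : l s w (v t) = l s w Y0 + t * l s w v1.
  by rewrite /l /v crossDl crossZl dotDr dotZr.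
have Dev s t : De s (v t) = De s Y0 + t * De s v1.
  by rewrite /De /v crossDl crossZl dotDl dotZl.
have vvE t : dot (v t) (v t)
    = dot Y0 Y0 + 2 * t * dot Y0 v1 + t ^+ 2 * dot v1 v1.
  by rewrite /v; move: (v1) => u; rewrite !dotE (dotC u Y0); ring.
have Phiv1 : Phi v1 = 0.
  apply: (@cubic_lead_eq0 (fun t => Phi (v t))) => // t.
  by rewrite /Phi !Tv !lv !Dev !vvE; ring.
have De1 : De s1 v1 = 0.
  by rewrite /De /v1 crossDl !crossZl crossxx scaler0 add0r dotZl dotC
    dot_crossxx mulr0.
have De2 : De s2 v1 = a * dot (cross s1 s2) nu.
  rewrite /De /v1 crossDl !crossZl dotDl !dotZl [dot (cross nu s2) nu]dotC.
  by rewrite dot_crossxx mulr0 addr0.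
have l1 : l s1 w1 v1 = be * dot w1 (cross nu s1).
  by rewrite /l /v1 crossDl !crossZl crossxx scaler0 add0r dotZr.
have T1 : T s1 v1 = a * (K - 2 * h1 ^+ 2) - be * h1.
  rewrite /T /v1 /refl !dotE (dotC nu s1) nu1 -/h1 -/K; ring.
have vv1 : dot v1 v1 = a ^+ 2 * K + 2 * a * be * h1 + be ^+ 2.
  by rewrite /v1 !dotE (dotC nu s1) nu1 -/h1 -/K; ring.
have z1 : be + h1 * a != 0.
  by move: z0; congr (_ != 0); rewrite /be /a; ring.
have a0 : a != 0 by rewrite subr_eq0.
have K0 : K != 0 by rewrite gt_eqF// dot_gt0.
move: Phiv1; rewrite /Phi De1 mulr0 subr0 De2 l1 T1 vv1 /M -/h1 => Phiv1.
have : 2 * a ^+ 2 * K * (be + h1 * a) * dot (cross s1 s2) nu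
    * dot w1 (cross nu s1) = 0.
  by rewrite -Phiv1; ring.
move/eqP; rewrite mulf_eq0 => /orP[|/eqP//].
by rewrite !mulf_eq0 (negbTE a0) (negbTE K0) (negbTE z1) (negbTE D0) pnatr_eq0.
Unshelve. all: by end_near. Qed.

End Covectors.

(** * Chain rule along curves *)

Section Gradient.
Variables (R : realType) (n : nat).
Implicit Types (f : 'rV[R]_n -> R) (s x v : 'rV[R]_n).

Definition grad f x : 'rV[R]_n := \row_i partial i f x.

Lemma diff_grad f x v : differentiable f x -> 'd f x v = dot (grad f x) v.
Proof.
move=> df; rewrite {1}(row_sum_delta v) linear_sum /dot.
by apply: eq_bigr => i _; rewrite linearZ /= mxE /partial deriveE// mulrC.
Qed.

(** Continuity of [F] at 0 suffices: the difference quotient at 0 of the curve [s + d *: F d] is [F]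
    itself. *)
Lemma is_derive_curve f s (F : R -> 'rV[R]_n) :
  differentiable f s -> F d @[d --> 0] --> F 0 ->
  is_derive (0 : R) 1 (fun d => f (s + d *: F d)) (dot (grad f s) (F 0)).
Proof.
move=> df cF; pose c d := s + d *: F d.
have c0 : c 0 = s by rewrite /c scale0r addr0.
have cq : h^-1 *: (c (h *: 1 + 0) - c 0) @[h --> (0 : R)^'] --> F 0.
  apply: cvg_trans (@cvg_within_filter _ _ F _ _ _ (fun h => h != 0) cF).
  apply: near_eq_cvg; near=> h.
  have h0 : h != 0 by near: h; exact: nbhs_dnbhs_neq.
  rewrite c0 addr0 /c [h *: 1]mulr1 addrC addKr scalerA mulVf ?scale1r//.
have dc : derivable c 0 1 by apply/cvg_ex; exists (F 0).
have Dc : 'D_1 c 0 = F 0 by apply/cvg_lim.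
have dc' : differentiable c 0 by exact/derivable1_diffP.
have dfc : differentiable f (c 0) by rewrite c0.
have dfoc := differentiable_comp dc' dfc.
apply: (@DeriveDef _ _ _ _ _ (f \o c)); first exact: diff_derivable.
by rewrite deriveE// diff_comp//= -diff_grad// c0 -Dc deriveE.
Unshelve. all: by end_near. Qed.

Lemma grad_curve_eq f1 f2 s1 s2 (F1 F2 : R -> 'rV[R]_n) :
  differentiable f1 s1 -> differentiable f2 s2 ->
  F1 d @[d --> 0] --> F1 0 -> F2 d @[d --> 0] --> F2 0 ->
  (\forall d \near 0, f1 (s1 + d *: F1 d) = f2 (s2 + d *: F2 d)) ->
  dot (grad f1 s1) (F1 0) = dot (grad f2 s2) (F2 0).
Proof.
move=> df1 df2 cF1 cF2 E.
have [_ <-] := is_derive_curve df1 cF1; have [_ <-] := is_derive_curve df2 cF2.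
by apply: near_eq_derive => //; rewrite oner_eq0.
Qed.

End Gradient.

(** * From the functional equation to a relation between gradients *)

Section LocalSystem.
Variables (R : realType) (nu : 'rV[R]_3) (K : R).
Variables (b g : 'rV[R]_3 -> R[i]) (U V : set 'rV[R]_3).
Hypotheses (nu1 : dot nu nu = 1) (openU : open U) (openV : open V).
Hypothesis loc : forall eta s, U eta -> V s -> dot eta eta = K -> dot s s = K ->
  [/\ b s * g (eta - s) + g (eta - refl nu s) = 0, g (eta - s) != 0, b s != 0 &
   forall a, differentiable (fun x => complex.Re (a * b x)) s].
Implicit Types (s Y : 'rV[R]_3) (a : R[i]).

(** If [Y = eta - refl nu s], this vector is [eta - s]. *)
Let base s Y := Y - (2 * dot s nu) *: nu.

Let base_refl s Y : base s Y + s = Y + refl nu s.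
Proof. by rewrite /base /refl addrAC addrA. Qed.

Let det_base s Y : dot (cross (base s Y) s) nu = dot (cross Y s) nu.
Proof.
rewrite crossDl crossNl crossZl dotDl dotNl dotZl.
by rewrite [dot (cross nu s) nu]dotC dot_crossxx mulr0 subr0.
Qed.

(** Let [s] move to [c d] on the circle about the axis [base s Y], and put [eta = base s Y + c d].
    Then [eta - c d] stays fixed while [eta - refl nu (c d)] is [Y + (2 * d) *: nu]. The system
    makes [b (c d)] a constant multiple of [g] there, and dividing by the case d = 0 removes the
    constant. *)
Lemma local_curve s Y : V s -> dot s s = K -> U (Y + refl nu s) ->
  dot Y Y + 2 * dot Y (refl nu s) = 0 -> dot (cross Y s) nu != 0 ->
  exists F : R -> 'rV[R]_3, [/\ F d @[d --> 0] --> F 0,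
    F 0 = (dot (cross Y s) nu)^-1 *: cross (base s Y) s &
    \forall d \near 0, b (s + d *: F d) / b s = g (Y + (2 * d) *: nu) / g Y].
Proof.
move=> Vs sK UY EY D0.
have [|F [cF F0 Fcirc]] := @circle_curve R (base s Y) s nu.
  by rewrite det_base.
exists F; split => //; first by rewrite F0 det_base.
pose c d := s + d *: F d.
have cc : c d @[d --> (0 : R)] --> s.
  rewrite -[X in _ --> X]addr0 -(scale0r (F 0)).
  by apply: cvgD; [exact: cvg_cst|apply: cvgZ; [exact: cvg_id|]].
(* This says that [base s Y + s] has the norm of [s]; as the circle preserves
   [dot (c d) (base s Y)], the vector [base s Y + c d] keeps that norm too. *)
have yK : dot (base s Y) (base s Y) + 2 * dot s (base s Y) = 0.
  have := dot_sqrD (base s Y) s.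
  by rewrite base_refl dot_sqrD dot_refl// (dotC s); move: EY; lra.
have key d : V (c d) -> U (base s Y + c d) -> dot (c d) (c d) = dot s s ->
    dot (c d) (base s Y) = dot s (base s Y) ->
    dot (c d) nu = dot s nu + d ->
    b (c d) * g (base s Y) = - g (Y + (2 * d) *: nu) /\ g (base s Y) != 0.
  move=> Vc Uc cK cy cnu.
  have [] := loc Uc Vc.
  - by rewrite dot_sqrD dotC cy cK yK add0r.
  - by rewrite cK.
  rewrite addrK => E gb _ _; split => //; apply/eqP; rewrite -addr_eq0.
  rewrite -E; apply/eqP; congr (_ + g _).
  rewrite /refl cnu /base opprB addrA; apply/rowP => i; rewrite !mxE; ring.
have [b0 bs0] : b s * g (base s Y) = - g Y /\ g (base s Y) != 0.
  have := key 0; rewrite /c scale0r mulr0 scale0r !addr0; apply => //.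
  by rewrite base_refl.
have [_ _ bsn0 _] : [/\ b s * g (Y + refl nu s - s)
    + g (Y + refl nu s - refl nu s) = 0, g (Y + refl nu s - s) != 0, b s != 0 &
   forall a, differentiable (fun x => complex.Re (a * b x)) s].
  by apply: loc => //; rewrite dot_sqrD dot_refl// EY add0r.
near=> d.
have Vc : V (c d).
  by near: d; apply: (cc V); exact: open_nbhs_nbhs.
have Uc : U (base s Y + c d).
  near: d.
  have : base s Y + c d @[d --> (0 : R)] --> base s Y + s.
    by apply: cvgD; [exact: cvg_cst|].
  by apply; rewrite base_refl; exact: open_nbhs_nbhs.
have [cK cy cnu] : [/\ dot (c d) (c d) = dot s s,
   dot (c d) (base s Y) = dot s (base s Y) & dot (c d) nu = dot s nu + d].
  by near: d.
have [bd _] := key d Vc Uc cK cy cnu.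
rewrite -/(c d).
have gY : g Y != 0 by rewrite -oppr_eq0 -b0 mulf_neq0.
apply/eqP; rewrite eqr_div//; apply/eqP.
apply: (mulIf bs0); rewrite mulrAC bd.
by rewrite -mulrA b0 mulrN mulNr.
Unshelve. all: by end_near. Qed.

(** Both normalised curves of values of [b] equal the same quotient of values of [g]. Multiplying by
    [a * b s1] and taking real parts gives two real functions that agree near d = 0; the relation is
    the equality of their derivatives, cleared of denominators. *)
Lemma local_gradient_relation a s1 s2 Y :
  V s1 -> V s2 -> dot s1 s1 = K -> dot s2 s2 = K ->
  U (Y + refl nu s1) -> U (Y + refl nu s2) ->
  dot Y Y + 2 * dot Y (refl nu s1) = 0 ->
  dot Y Y + 2 * dot Y (refl nu s2) = 0 ->
  dot (cross Y s1) nu != 0 -> dot (cross Y s2) nu != 0 ->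
  dot (grad (fun x => complex.Re (a * b x)) s1)
    (cross (base s1 Y) s1) * dot (cross Y s2) nu =
  dot (grad (fun x => complex.Re (a * b s1 / b s2 * b x)) s2)
    (cross (base s2 Y) s2) * dot (cross Y s1) nu.
Proof.
move=> V1 V2 K1 K2 U1 U2 E1 E2 D1 D2.
have [F1 [cF1 F10 R1]] := local_curve V1 K1 U1 E1 D1.
have [F2 [cF2 F20 R2]] := local_curve V2 K2 U2 E2 D2.
have UK s : dot s s = K -> dot Y Y + 2 * dot Y (refl nu s) = 0 ->
    dot (Y + refl nu s) (Y + refl nu s) = K.
  by move=> sK E; rewrite dot_sqrD dot_refl// E add0r.
have [_ _ b1 df1] := loc U1 V1 (UK _ K1 E1) K1.
have [_ _ b2 df2] := loc U2 V2 (UK _ K2 E2) K2.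
have := grad_curve_eq (df1 a) (df2 (a * b s1 / b s2)) cF1 cF2.
rewrite F10 F20 !dotZr => E.
apply: (mulfI (mulf_neq0 (invr_neq0 D1) (invr_neq0 D2))).
set G1 := dot _ (cross (base s1 Y) s1) in E *.
set G2 := dot _ (cross (base s2 Y) s2) in E *.
transitivity ((dot (cross Y s1) nu)^-1 * G1); first by field; rewrite D1 D2.
rewrite E; first by field; rewrite D1 D2.
near=> d.
have e1 : b (s1 + d *: F1 d) / b s1 = g (Y + (2 * d) *: nu) / g Y by near: d.
have e2 : b (s2 + d *: F2 d) / b s2 = g (Y + (2 * d) *: nu) / g Y by near: d.
congr (complex.Re _).
have -> : b (s1 + d *: F1 d) = b (s2 + d *: F2 d) / b s2 * b s1.
  by rewrite e2 -e1 divfK.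
by field.
Unshelve. all: by end_near. Qed.

End LocalSystem.

(** * Perturbation on a sphere off a hyperplane *)

Section Generic.
Variable R : realType.

Lemma sphere_generic n (s0 w : 'rV[R]_n) (V : set 'rV[R]_n) :
  w != 0 -> s0 != 0 -> nbhs s0 V ->
  exists s, [/\ V s, dot s s = dot s0 s0 & dot s w != 0].
Proof.
move=> w0 s00 Vs0; have [s0w|] := eqVneq (dot s0 w) 0; last first.
  by exists s0; split => //; exact: nbhs_singleton.
have ww := dot_gt0 w0; have ss := dot_gt0 s00.
(* [c *: w] has the length of [s0] and is orthogonal to it, so [p] is the rational parametrisation
   of a great circle through [s0]. *)
pose c := Num.sqrt (dot s0 s0 / dot w w).
have c0 : c != 0 by rewrite gt_eqF// sqrtr_gt0 divr_gt0.
have c2 : c ^+ 2 * dot w w = dot s0 s0.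
  by rewrite sqr_sqrtr ?divfK ?gt_eqF// ltW// divr_gt0.
pose p (u : R) : 'rV_n := ((1 - u ^+ 2) / (1 + u ^+ 2)) *: s0
  + (2 * u / (1 + u ^+ 2)) *: (c *: w).
have u1 (u : R) : 1 + u ^+ 2 != 0 by rewrite gt_eqF// ltr_pwDl// sqr_ge0.
have p0 : p 0 = s0.
  by rewrite /p expr0n mulr0 mul0r scale0r addr0 subr0 addr0 divr1 scale1r.
have cu : 1 + u ^+ 2 @[u --> (0 : R)] --> (1 + 0 ^+ 2 : R).
  by apply: cvgD; [exact: cvg_cst|apply: cvgM].
have cp : p u @[u --> (0 : R)] --> s0.
  rewrite -p0; apply: cvgD; apply: cvgZ; try exact: cvg_cst.
    apply: cvgM; last exact: cvgV.
    by apply: cvgB; [exact: cvg_cst|apply: cvgM].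
  apply: cvgM; last exact: cvgV.
  by apply: cvgM; [exact: cvg_cst|].
have : exists u, [/\ V (p u), dot (p u) (p u) = dot s0 s0 & dot (p u) w != 0].
  apply: (@filter_ex _ (0 : R)^'); near=> u.
  have u0 : u != 0 by near: u; exact: nbhs_dnbhs_neq.
  split; first by near: u; apply: cvg_within; exact: cp.
    rewrite dot_sqrD !dotE s0w -!/(dot w w).
    transitivity (((1 - u ^+ 2) / (1 + u ^+ 2)) ^+ 2 * dot s0 s0
      + (2 * u / (1 + u ^+ 2)) ^+ 2 * (c ^+ 2 * dot w w)); first by ring.
    by rewrite c2; field.
  have cw : c * dot w w != 0 by rewrite mulf_neq0// gt_eqF.
  rewrite !dotE s0w mulr0 add0r mulf_neq0// mulf_neq0 ?invr_neq0//.
  by rewrite mulf_neq0// pnatr_eq0.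
by move=> [u Pu]; exists (p u).
Unshelve. all: by end_near. Qed.

Lemma exists_orthogonal (nu : 'rV[R]_3) :
  exists2 w : 'rV[R]_3, w != 0 & dot w nu = 0.
Proof.
have [z|z] := eqVneq (cross nu (delta_mx 0 0)) 0; last first.
  by exists (cross nu (delta_mx 0 0)) => //; rewrite dotC dot_crossxx.
exists (delta_mx 0 1).
  by apply/eqP => /rowP/(_ 1)/eqP; rewrite !mxE !eqxx oner_eq0.
move/rowP/(_ 2): z; rewrite !mxE !ord3_eq dot3E !mxE /= => z.
by lra.
Qed.

End Generic.

(** * Vanishing of the tangential derivative at a generic point *)

Section LocalTheorem.
Variables (R : realType) (nu : 'rV[R]_3) (K : R).
Variables (b g : 'rV[R]_3 -> R[i]) (U V : set 'rV[R]_3).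
Hypotheses (nu1 : dot nu nu = 1) (openU : open U) (openV : open V).
Hypothesis K0 : 0 < K.
Hypothesis loc : forall eta s, U eta -> V s -> dot eta eta = K -> dot s s = K ->
  [/\ b s * g (eta - s) + g (eta - refl nu s) = 0, g (eta - s) != 0, b s != 0 &
   forall a, differentiable (fun x => complex.Re (a * b x)) s].

Lemma local_tangential_derivative eta0 s1 a :
  U eta0 -> dot eta0 eta0 = K -> V s1 -> dot s1 s1 = K ->
  dot s1 nu != 0 -> cross s1 nu != 0 ->
  dot (grad (fun x => complex.Re (a * b x)) s1) (cross nu s1) = 0.
Proof.
move=> Ueta0 eta0K V1 K1 h1 x1.
pose t1 := refl nu s1.
have t1K : dot t1 t1 = K by rewrite dot_refl.
have x1E : cross t1 nu = cross s1 nu.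
  by rewrite /t1 /refl crossDl crossNl crossZl crossxx scaler0 subr0.
(* [n2] is orthogonal to [t1], and [dot n2 nu] is the squared norm of [cross t1 nu]. For
   [Y = eta - t1], the two nondegeneracy conditions on [Y] become that [eta] is orthogonal neither
   to [cross t1 nu] nor to [n2]; two successive perturbations of [eta0] achieve this. *)
pose n2 := K *: nu - dot t1 nu *: t1.
have n20 : n2 != 0.
  apply: contra_neq x1 => n20; apply: dot_eq0.
  rewrite -x1E lagrange_identity t1K nu1 (dotC nu).
  have : dot n2 nu = 0 by rewrite n20 dot0l.
  by rewrite /n2 !dotE nu1.
have nz (x : 'rV[R]_3) : dot x x = K -> x != 0.
  by move=> xK; apply/eqP => x0; move: K0; rewrite -xK x0 dot0l ltxx.
have openD (w : 'rV[R]_3) x : dot x w != 0 -> nbhs x [set y | dot y w != 0].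
  by move=> xw; exact: near_neq0 (@continuous_dotr _ _ w x) xw.
have x1' : cross t1 nu != 0 by rewrite x1E.
have [eta1 [Ueta1 eta1K e1]] :=
  sphere_generic x1' (nz _ eta0K) (open_nbhs_nbhs (conj openU Ueta0)).
rewrite eta0K in eta1K.
have [eta [[Ueta e2] etaK e3]] := sphere_generic n20 (nz _ eta1K)
  (filterI (open_nbhs_nbhs (conj openU Ueta1)) (openD _ _ e1)).
rewrite eta1K /= in etaK e2.
pose Y := eta - t1.
have Yt1 : Y + t1 = eta by rewrite subrK.
have YE s : dot s s = K -> dot (Y + refl nu s) (Y + refl nu s) = K <->
    dot Y Y + 2 * dot Y (refl nu s) = 0.
  by move=> sK; rewrite dot_sqrD dot_refl// sK; split; lra.
have EY1 : dot Y Y + 2 * dot Y t1 = 0 by apply/YE => //; rewrite Yt1.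
have D1 : dot (cross Y t1) nu != 0.
  by rewrite /Y crossDl crossNl crossxx subr0 dot_crossC.
have D1' : dot (cross Y s1) nu != 0.
  move: D1; rewrite /t1 /refl crossDr crossNr crossZr dotDl dotNl dotZl.
  by rewrite [dot (cross Y nu) nu]dotC dot_crossxy mulr0 subr0.
have G1 : dot t1 t1 * dot Y nu - dot t1 Y * dot t1 nu != 0.
  move: e3; congr (_ != 0); rewrite /Y /n2; move: (t1) t1K => t tK.
  by rewrite !dotE tK (dotC t eta); ring.
pose W := V `&` [set s | U (Y + refl nu s)]
  `&` [set s | dot (cross Y s) nu != 0].
have W1 : nbhs s1 W.
  apply: filterI; first apply: filterI.
  - exact: open_nbhs_nbhs.
  - have : Y + refl nu s @[s --> s1] --> Y + t1.
      exact: (@cvg_add_refl _ nu Y _ (nbhs s1) _ id).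
    by apply; rewrite Yt1; exact: open_nbhs_nbhs.
  - have -> : [set s | dot (cross Y s) nu != 0]
        = [set s | dot s (cross nu Y) != 0].
      by apply/seteqP; split => s /=;
        rewrite dot_crossC [dot Y _]dotC dot_crossC.
    by apply: openD; rewrite -dot_crossC dotC -dot_crossC.
have [s2 [[[V2 U2] D2] K2 E2 [h12 z0 d0]]] :=
  exists_second_point nu1 W1 h1 D1 G1.
rewrite /= in U2 D2; rewrite K1 in K2.
have EY2 : dot Y Y + 2 * dot Y (refl nu s2) = 0.
  by rewrite [dot Y (refl _ _)]dotC E2 [dot (refl _ _) Y]dotC.
apply: (@tangential_covector_eq0 R nu s1 s2 Y _
  (grad (fun x => complex.Re (a * b s1 / b s2 * b x)) s2)) => //.
- by rewrite K1.
- exact: nz.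
- by apply: contra_neq D1 => ->; rewrite -(scale0r 0) crossZl scale0r dot0l.
near=> Z => Z1 Z2; apply: (local_gradient_relation nu1 openU openV loc) => //.
- near: Z; have : Z + refl nu s1 @[Z --> Y] --> Y + t1.
    exact: (@cvgD R _ _ (nbhs Y) _ id (fun=> t1) _ _ cvg_id (cvg_cst _)).
  by apply; rewrite Yt1; exact: open_nbhs_nbhs.
- near: Z; have : Z + refl nu s2 @[Z --> Y] --> Y + refl nu s2.
    exact: (@cvgD R _ _ (nbhs Y) _ id (fun=> refl nu s2) _ _ cvg_id
      (cvg_cst _)).
  by apply; exact: open_nbhs_nbhs.
- rewrite dot_crossC; near: Z; apply: openD; by rewrite -dot_crossC.
- rewrite dot_crossC; near: Z; apply: openD; by rewrite -dot_crossC.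
Unshelve. all: by end_near. Qed.

End LocalTheorem.

(** * Radial invariance and the complex line of the projected normal *)

Section ComplexGradient.
Variable R : realType.
Implicit Types (b : 'rV[R]_3 -> R[i]) (nu s w : 'rV[R]_3).

Lemma grad_radial_eq0 (f : 'rV[R]_3 -> R) s : differentiable f s ->
  (\forall t \near (1 : R), f (t *: s) = f s) -> dot (grad f s) s = 0.
Proof.
move=> df fs; rewrite -(dot0r (grad f s)).
apply: (@grad_curve_eq _ _ f f s s (fun=> s) (fun=> 0)) => //;
  try exact: cvg_cst.
have c1 : 1 + d @[d --> (0 : R)] --> (1 : R).
  by rewrite -[X in _ --> X]addr0; apply: cvgD; [exact: cvg_cst|].
near=> d; rewrite scaler0 addr0 -{1}[s]scale1r -scalerDl.
by near: d; exact: (c1 _ fs).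
Unshelve. all: by end_near. Qed.

(** The vectors [s], [cross nu s] and [cross s (cross nu s)] form an orthogonal basis, and the third
    is [dot s s *: oproj s nu]. *)
Lemma orthogonal_oproj nu s w : cross nu s != 0 ->
  dot w s = 0 -> dot w (cross nu s) = 0 -> exists c, w = c *: oproj s nu.
Proof.
move=> ns0 ws wns; have ns := dot_gt0 ns0.
have s0 : dot s s != 0.
  apply: contra_neq ns0 => /dot_eq0 ->.
  by rewrite -(scale0r 0) crossZr !scale0r.
have detE : dot (cross s (cross nu s)) nu = dot (cross nu s) (cross nu s).
  by rewrite [LHS]dotC -[LHS]dot_crossC.
have crE : cross s (cross nu s) = dot s s *: oproj s nu.
  rewrite /oproj /enorm sqr_sqrtr ?dot_ge0// scalerBr scalerA.
  rewrite mulrCA divff// mulr1.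
  by apply/row3P; rewrite !dot3E !mxE !ord3_eq; ring.
exists ((dot (cross nu s) (cross nu s))^-1 * dot w nu * dot s s).
rewrite -[_ * dot w nu * _]mulrA -scalerA -scalerA -crE.
have := cramer3 s (cross nu s) nu w.
rewrite ws wns !scale0r !add0r detE => <-.
by rewrite scalerA mulVf ?scale1r// gt_eqF.
Qed.

Lemma cline_gradC b nu s : cross nu s != 0 ->
  dot (grad (fun x => complex.Re (b x)) s) s = 0 ->
  dot (grad (fun x => complex.Re (b x)) s) (cross nu s) = 0 ->
  dot (grad (fun x => complex.Im (b x)) s) s = 0 ->
  dot (grad (fun x => complex.Im (b x)) s) (cross nu s) = 0 ->
  cline (oproj s nu) (gradC b s).
Proof.
move=> ns0 re1 re2 im1 im2.
have [p pE] := orthogonal_oproj ns0 re1 re2.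
have [q qE] := orthogonal_oproj ns0 im1 im2.
exists (p +i* q) => //; apply/rowP => i.
move/rowP/(_ i): pE; move/rowP/(_ i): qE; rewrite !mxE => -> ->.
by apply/eqP; rewrite eq_complex /= !mulr0 subr0 add0r !eqxx.
Qed.

End ComplexGradient.

(** * Localisation near a nonzero value and contradiction with density *)

Theorem theorem5p7 (R : realType) (k0 chi : R) (nu omega : 'rV[R]_3)
    (b : 'rV[R]_3 -> R[i])
    (k0_gt0 : 0 < k0) (nu_unit : enorm nu = 1) (omega_unit : enorm omega = 1)
    (chi_gt0 : 0 < chi) (chi_lt1 : chi < 1)
    (b_neq0 : forall x, Sigma2chi k0 nu omega chi x -> b x <> 0)
    (b_homog : forall s t, Sigma2 k0 nu omega s -> 1 - chi < t < 1 + chi ->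
       b (t *: s) = b s)
    (b_C2 : CkC 2 (Sigma2chi k0 nu omega chi) b)
    (b_dense :
       closure [set s | Sigma2 k0 nu omega s /\ ~ cline (oproj s nu) (gradC b s)]
         `&` Sigma2 k0 nu omega = Sigma2 k0 nu omega)
    (g : 'rV[R]_3 -> R[i]) (g_cont : continuousC g)
    (g_sol : HS k0 nu omega b g) :
  forall y, (Y1 k0 nu omega `|` Y2 k0 nu omega) y -> g y = 0.
Proof.
have nu1 : dot nu nu = 1.
  by rewrite -[RHS](expr1n _ 2); apply/(sphereE nu (@ltr01 R)).
have K0 : 0 < k0 ^+ 2 by rewrite exprn_gt0.
move=> y [[eta capeta [s Ss <-]]|[eta0 cap0 [s0 S0 <-]]].
  exact: (g_sol eta capeta).1.
apply/eqP; apply: contrapT => /negP g0.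
have capE v x : cap k0 v x <-> dot x x = k0 ^+ 2 /\ 0 < dot x v.
  by rewrite /cap /=; split=> -[/(sphereE _ k0_gt0)].
have SE x : Sigma2 k0 nu omega x <->
    [/\ dot x x = k0 ^+ 2, 0 < dot x omega & 0 < dot (refl nu x) omega].
  rewrite /Sigma2 /= !capE dot_refl//.
  by split=> [[[? ?] [? ?]]|[? ? ?]].
have [eta0K eta0p] := (capE _ _ _).1 cap0.
have [s0K s0p s0p'] := (SE _).1 S0.
have Schi s : Sigma2 k0 nu omega s -> Sigma2chi k0 nu omega chi s.
  move=> Ss; exists s => //; exists 1; last by rewrite scale1r.
  by rewrite /= in_itv /= ltrBlDr ltrDl chi_gt0.
have dre s : Sigma2 k0 nu omega s ->
    differentiable (fun x => complex.Re (b x)) s.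
  by move=> /Schi; exact: b_C2.1.1.
have dim s : Sigma2 k0 nu omega s ->
    differentiable (fun x => complex.Im (b x)) s.
  by move=> /Schi; exact: b_C2.2.1.
have [[U0 V0] /= [U0eta V0s] gUV] :
    nbhs (eta0, s0) [set p | g (p.1 - p.2) != 0].
  have gx : \forall x \near eta0 - s0, g x != 0.
    exact: (@cvgr_neq0 _ R[i]^o _ _ _ g _ (g_cont (eta0 - s0)) g0).
  have : p.1 - p.2 @[p --> (eta0, s0)] --> eta0 - s0.
    exact: (@cvgB R 'rV[R]_3 _ (nbhs (eta0, s0)) _ fst snd _ _ cvg_fst cvg_snd).
  by move=> /(_ [set x | g x != 0]); exact.
(* The strict inequalities defining the caps persist on neighbourhoods, where the sphere equation
   alone then gives membership in the cap and in [Sigma2]. *)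
pose U1 := U0 `&` [set x | 0 < dot x (e3 R)].
pose V1 := V0 `&` [set x | 0 < dot x omega]
  `&` [set x | 0 < dot (refl nu x) omega].
have U1eta : nbhs eta0 U1.
  apply: filterI => //.
  have : dot x (e3 R) @[x --> eta0] --> dot eta0 (e3 R).
    by exact: continuous_dotr.
  by move=> /cvgr_gt; exact.
have V1s : nbhs s0 V1.
  apply: filterI; first apply: filterI => //.
    have : dot x omega @[x --> s0] --> dot s0 omega by exact: continuous_dotr.
    by move=> /cvgr_gt; exact.
  have : dot (refl nu x) omega @[x --> s0] --> dot (refl nu s0) omega.
    by under eq_fun do rewrite dot_reflC; rewrite dot_reflC;
      exact: continuous_dotr.
  by move=> /cvgr_gt; exact.
have [U [openU Ueta] UU1] : exists2 U, open_nbhs eta0 U & U `<=` U1.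
  by move: U1eta; rewrite nbhsE.
have [V [openV Vs] VV1] : exists2 V, open_nbhs s0 V & V `<=` V1.
  by move: V1s; rewrite nbhsE.
have VS s : V s -> dot s s = k0 ^+ 2 -> Sigma2 k0 nu omega s.
  by move=> /VV1[[_ ?] ?] ?; apply/SE.
have loc eta s : U eta -> V s -> dot eta eta = k0 ^+ 2 -> dot s s = k0 ^+ 2 ->
  [/\ b s * g (eta - s) + g (eta - refl nu s) = 0, g (eta - s) != 0, b s != 0 &
   forall a, differentiable (fun x => complex.Re (a * b x)) s].
  move=> Ue Vs' eK sK.
  have Ss := VS _ Vs' sK.
  have [U0e e3e] := UU1 _ Ue; have [[V0s' _] _] := VV1 _ Vs'.
  split.
  - by apply: (g_sol eta _).2 => //; apply/capE.
  - exact: (gUV (eta, s)).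
  - by apply/eqP; apply: b_neq0; exact: Schi.
  move=> [p q].
  have -> : (fun x => complex.Re ((p +i* q) * b x)) =
      (p \*: (fun x => complex.Re (b x))) \- (q \*: (fun x => complex.Im (b x))).
    by apply/funext => x /=; case: (b x) => u v.
  by apply: differentiableB; apply: differentiableZ; [exact: dre|exact: dim].
(* A point not orthogonal to [w] is not parallel to [nu]; this turns the requirement
   [cross nu s != 0] into the open condition [dot s w != 0]. *)
have [w w0 wnu] := exists_orthogonal nu.
have nu0 : nu != 0.
  apply/eqP => nu0; move: nu1; rewrite nu0 dot0l => /eqP.
  by rewrite eq_sym oner_eq0.
have nz (x : 'rV[R]_3) : dot x x = k0 ^+ 2 -> x != 0.
  by move=> xK; apply/eqP => x0; move: K0; rewrite -xK x0 dot0l ltxx.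
have openD (v : 'rV[R]_3) x : dot x v != 0 -> nbhs x [set y | dot y v != 0].
  by move=> xv; exact: near_neq0 (@continuous_dotr _ _ v x) xv.
have openVx x : V x -> nbhs x V by move=> Vx; exact: open_nbhs_nbhs.
have [s1 [Vs1 s1K s1nu]] := sphere_generic nu0 (nz _ s0K) (openVx _ Vs).
rewrite s0K in s1K.
have [s2 [[Vs2 s2nu] s2K s2w]] := sphere_generic w0 (nz _ s1K)
  (filterI (openVx _ Vs1) (openD _ _ s1nu)).
rewrite s1K /= in s2K s2nu.
have cl2 : closure [set s | Sigma2 k0 nu omega s /\
    ~ cline (oproj s nu) (gradC b s)] s2.
  have : Sigma2 k0 nu omega s2 by exact: VS.
  by rewrite -[X in X _]b_dense => -[].
(* Density moves [s2] to a point whose gradient is off the line, without losing the open conditions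
   already secured. *)
have [s [[Ss grads] [[Vs' snu] sw]]] := cl2 _
  (filterI (filterI (openVx _ Vs2) (openD _ _ s2nu)) (openD _ _ s2w)).
rewrite /= in snu sw.
have [sK _ _] := (SE _).1 Ss.
have nus : cross nu s != 0.
  apply: contra_neq sw => nus0; have := lagrange_identity nu s nu w.
  by rewrite nus0 dot0l nu1 (dotC nu w) wnu mul0r subr0 mul1r.
have snus : cross s nu != 0 by rewrite crossC oppr_eq0.
have tang a := local_tangential_derivative nu1 openU openV K0 loc a
  Ueta eta0K Vs' sK snu snus.
have homog (f : R[i] -> R) : \forall t \near (1 : R), f (b (t *: s)) = f (b s).
  near=> t; congr f; apply: b_homog => //; apply/andP; split.
  - near: t; apply: (cvgr_gt _ cvg_id); rewrite ltrBlDr ltrDl//.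
  - near: t; apply: (cvgr_lt _ cvg_id); rewrite ltrDl//.
apply: grads; apply: cline_gradC => //.
- by apply: grad_radial_eq0; [exact: dre|exact: homog].
- rewrite (_ : (fun x => _) = fun x => complex.Re (1 * b x)); first exact: tang.
  by apply/funext => x; rewrite mul1r.
- by apply: grad_radial_eq0; [exact: dim|exact: homog].
(* The imaginary part of z is the real part of -i z, so the multiplier [a] is -i here. *)
- rewrite (_ : (fun x => _) = fun x => complex.Re ((0 -i* 1) * b x)).
    exact: tang.
  apply/funext => x; case: (b x) => u v /=.
  by rewrite mul0r mulN1r opprK add0r.
Unshelve. all: by end_near. Qed.
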